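(* Let $k$ be a field, $\sigma$ an arbitrary index set, and fix a monomial order on the exponent vectors of $k[x_i]_{i\in\sigma}$. For any polynomial $f \in k[x_i]_{i\in\sigma}$ and any ordered tuple of polynomials $(f_1,\ldots,f_s)$ in $k[x_i]_{i\in\sigma}$, there exist polynomials $a_1,\ldots,a_s \in k[x_i]_{i\in\sigma}$ and a polynomial $r\in k[x_i]_{i\in\sigma}$ such that $$f = a_1 f_1 + \cdots + a_s f_s + r,$$ and $r$ is a remainder of $f$ on division by the set $\{f_1,\ldots,f_s\}$.
   Context: Let $\mathcal{M} = (\sigma \to_0 \mathbb{N})$ be the set of finitely supported functions $\sigma\to\mathbb{N}$ (exponent vectors); $\sigma$ may be infinite. A monomial order is a binary relation $\le$ on $\mathcal{M}$ such that (1) $\le$ is a well-order (a linear order with no infinite strictly descending chain), (2) $a\le b$ implies $a+c\le b+c$ for all $a,b,c\in\mathcal{M}$, and (3) $0\le a$ for all $a\in\mathcal{M}$. For a nonzero polynomial $f=\sum_{j\in\mathcal{M}} a_j x^j$, its degree is $\deg(f)=\max\{j\in\mathcal{M} : a_j\ne 0\}$ (maximum with respect to the monomial order), and its leading monomial is $\mathrm{LM}(f)=x^{\deg(f)}$. For the zero polynomial, $\deg(0)=\bot$, an adjoined element strictly smaller than all exponent vectors, and $\mathrm{LM}(0)=0$. Remainder: let $f$ be a polynomial and $B$ a set of polynomials in $k[x_i]_{i\in\sigma}$. A polynomial $r$ is called a remainder of $f$ on division by $B$ if there is a finitely supported function $g:B\to k[x_i]_{i\in\sigma}$ such that (1) $f=\sum_{b\in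 B} g(b)\,b + r$; (2) $\deg(g(b)b)\le\deg(f)$ for every $b\in B$; and (3) no term of $r$ is divisible by the leading monomial of any nonzero element of $B$. *)

(* Defs.v *)
From mathcomp Require Import all_boot all_order all_algebra.
From mathcomp Require Import finmap.
From mathcomp Require Import boolp classical_sets.
From mathcomp Require Import monalg.

Set Implicit Arguments.
Unset Strict Implicit.
Unset Printing Implicit Defensive.

Import GRing.Theory.

Local Open Scope ring_scope.

(* The polynomial ring k[x_i]_{i in sigma} is [{malg k[{cmonom sigma}]}], the
   algebra of the commutative monoid [{cmonom sigma}] of finitely supported
   functions sigma -> nat.  The library writes this monoid multiplicatively:
   [mmul a c] is the exponent vector a + c (pointwise), [mone] is the
   exponent vector 0, and [<< c *g j >>] is the term c x^j. *)

Record monomial_order (sigma : choiceType) (le : rel {cmonom sigma}) : Prop := {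
  mo_refl : reflexive le;
  mo_anti : antisymmetric le;
  mo_trans : transitive le;
  mo_total : total le;
  mo_nochain : ~ exists u : nat -> {cmonom sigma},
    forall n : nat, le (u n.+1) (u n) /\ u n.+1 <> u n;
  mo_add : forall a b c : {cmonom sigma}, le a b -> le (mmul a c) (mmul b c);
  mo_zero : forall a : {cmonom sigma}, le mone a
}.

Section Degree.
Variables (k : fieldType) (sigma : choiceType) (le : rel {cmonom sigma}).
Implicit Types (f b r : {malg k[{cmonom sigma}]}) (d e : option {cmonom sigma}).

(* [None] is the adjoined bottom element. *)
Definition ledeg d e : bool :=
  match d, e with
  | None, _ => true
  | Some _, None => false
  | Some i, Some j => le i j
  end.

Definition maxdeg d e : option {cmonom sigma} := if ledeg d e then e else d.

Definition deg f : option {cmonom sigma} :=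
  \big[maxdeg/None]_(j <- msupp f) Some j.

Definition LM f : {malg k[{cmonom sigma}]} :=
  if deg f is Some j then << j >> else 0.

Definition divides b f : Prop := exists h : {malg k[{cmonom sigma}]}, f = h * b.

(* A finitely supported g : B -> k[x_i] is encoded by its extension by 0 to all
   polynomials, so that its support is contained in B. *)
Definition is_remainder f (B : set {malg k[{cmonom sigma}]}) r : Prop :=
  exists g : {fsfun {malg k[{cmonom sigma}]} -> {malg k[{cmonom sigma}]} with 0},
    [/\ forall b, b \in finsupp g -> B b,
        f = \sum_(b <- finsupp g) g b * b + r,
        forall b, B b -> ledeg (deg (g b * b)) (deg f) &
        forall j, j \in msupp r ->
          forall b, B b -> b <> 0 -> ~ divides (LM b) << r@_j *g j >>].

Lemma deg0 : deg 0 = None.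
Proof. by rewrite /deg msupp0 big_nil. Qed.

(* [deg f] is the greatest element of the support of a nonzero f. *)
Lemma degP f : monomial_order le -> f != 0 ->
  exists j, [/\ deg f = Some j, j \in msupp f &
             forall i, i \in msupp f -> le i j].
Proof.
move=> mo; rewrite -msupp_eq0 /deg => f0.
have max_seq (t : seq {cmonom sigma}) : t != [::] -> exists j,
    [/\ \big[maxdeg/None]_(l <- t) Some l = Some j, j \in t &
     forall i, i \in t -> le i j].
  elim: t => [//|i t IH _].
  rewrite big_cons; case: t IH => [_|i' s /(_ isT) [j [-> js jmax]]].
    rewrite big_nil; exists i; split=> [//||l]; rewrite ?mem_seq1 // => /eqP ->.
    exact: mo_refl.
  rewrite /maxdeg /=; case: ifPn => ij.
    exists j; split=> // [|l]; first by rewrite in_cons js orbT.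
    by rewrite in_cons => /predU1P[-> //|/jmax].
  exists i; split=> // [|l]; first exact: mem_head.
  rewrite in_cons => /predU1P[->|/jmax lj]; first exact: mo_refl.
  apply: (mo_trans mo lj); by case/orP: (mo_total mo i j) => // h; rewrite h in ij.
have [|j [-> js jmax]] := max_seq (enum_fset (msupp f)); last by exists j.
apply: contraNneq f0 => h; apply/eqP/fsetP => i.
by rewrite in_fset0 -[LHS]/(i \in enum_fset (msupp f)) h.
Qed.

End Degree.

(* Main.v *)
(* Division algorithm, by well-founded induction on deg f. If some nonzero
   f_i has its leading monomial dividing that of f, a monomial multiple of f_i
   cancels the leading term of f; otherwise that term is moved to the
   remainder. Either way the degree drops strictly and no summand exceeds
   deg f. *)
Require Import Defs.
From mathcomp Require Import all_boot all_order all_algebra.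
From mathcomp Require Import finmap boolp classical_sets monalg.

Local Open Scope ring_scope.
Local Open Scope classical_set_scope.

Set Implicit Arguments.
Unset Strict Implicit.
Unset Printing Implicit Defensive.

Import GRing.Theory.

(** A point that is not accessible has an [R]-predecessor that is not accessible either; a choice
    function for such predecessors, iterated, yields an infinite descending chain. *)
Lemma nochain_wf (T : eqType) (R : rel T) :
  ~ (exists u : nat -> T, forall n, R (u n.+1) (u n)) ->
  well_founded (fun x y => R x y).
Proof.
move=> nochain x; apply: contrapT => nAx.
have next (y : {y | ~ Acc (fun x y => R x y) y}) :
    exists z : {y | ~ Acc (fun x y => R x y) y}, R (sval z) (sval y).
  case: y => y nAy; apply: contrapT => nz; apply: (nAy); constructor => z Rzy.
  by apply: contrapT => nAz; apply: nz; exists (exist _ z nAz).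
have [h hP] := choice next; apply: nochain.
by exists (fun n => sval (iter n h (exist _ x nAx))) => n /=; apply: hP.
Qed.

Lemma monomial_order_wf (sigma : choiceType) (le : rel {cmonom sigma}) :
  monomial_order le -> well_founded (fun a b => le a b && (a != b)).
Proof.
move=> mo; apply: (@nochain_wf _ (fun a b => le a b && (a != b))).
move=> [u uP]; apply: (mo_nochain mo); exists u => n.
by have /andP[lun /eqP] := uP n.
Qed.

Lemma cmonom_mulmI (sigma : choiceType) (m : {cmonom sigma}) :
  injective (mmul m).
Proof.
move=> a b ab; apply/eqP/cmP => i; apply: (@addnI (m i)).
by rewrite -!cmM ab.
Qed.

Section Division.
Variables (k : fieldType) (sigma : choiceType) (le : rel {cmonom sigma}).
Hypothesis mo : monomial_order le.
Local Notation poly := {malg k[{cmonom sigma}]}.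
Implicit Types (f g p q r : poly) (m j : {cmonom sigma}).
Implicit Types d e : option {cmonom sigma}.
Local Notation ledeg := (ledeg le).
Local Notation deg := (deg le).

(** Translation by [m] is injective on exponents, so only the term of [g] at [j] contributes to this
    coefficient. *)
Lemma mcoeffUM (c : k) m g j : (<< c *g m >> * g)@_(mmul m j) = c * g@_j.
Proof.
rewrite malgM_def fgmulUg raddf_sum /=.
under eq_bigr => i _ do rewrite mcoeffU (inj_eq (@cmonom_mulmI _ m)).
have [js|/mcoeff_outdom gj] := boolP (j \in msupp g).
  rewrite (big_fsetD1 j) //= eqxx big1_fset ?addr0 // => i.
  by rewrite in_fsetD1 => /andP[/negPf ->].
rewrite gj mulr0 big1_fset // => i _ _.
by have [->|] := eqVneq i j; rewrite ?gj ?mulr0 ?mul0rn.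
Qed.

Lemma ledeg_trans d e d' : ledeg d e -> ledeg e d' -> ledeg d d'.
Proof. by case: d e d' => [a|] [b|] [c|] //=; apply: mo_trans. Qed.

(** Turns degree bounds into statements about supports, with the zero polynomial included, so that
    bounds on sums and products follow from support inclusions. *)
Lemma deg_leP p d :
  reflect (forall i, i \in msupp p -> ledeg (Some i) d) (ledeg (deg p) d).
Proof.
have [->|p0] := eqVneq p 0.
  by rewrite deg0; constructor=> i; rewrite msupp0.
apply: (iffP idP); have [j [-> js jmax]] := degP mo p0; last exact.
by move=> jd i /jmax ij; apply: ledeg_trans jd.
Qed.

Lemma deg0_le d : ledeg (deg (0 : poly)) d.
Proof. by rewrite deg0. Qed.

Lemma deg_leD p q d :
  ledeg (deg p) d -> ledeg (deg q) d -> ledeg (deg (p + q)) d.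
Proof.
move=> /deg_leP pd /deg_leP qd; apply/deg_leP => i.
by move=> /(fsubsetP (msuppD_le _ _)); rewrite in_fsetU => /orP[/pd|/qd].
Qed.

Lemma deg_leN p d : ledeg (deg (- p)) d = ledeg (deg p) d.
Proof. by apply/deg_leP/deg_leP; rewrite msuppN. Qed.

Lemma deg_sum_le (I : finType) (P : pred I) (G : I -> poly) d :
  (forall i, P i -> ledeg (deg (G i)) d) -> ledeg (deg (\sum_(i | P i) G i)) d.
Proof.
move=> Gd; apply: (big_ind (fun p => ledeg (deg p) d)) => //.
  by rewrite deg0.
by move=> p q; apply: deg_leD.
Qed.

Lemma deg_leUM (c : k) m p j :
  deg p = Some j -> ledeg (deg (<< c *g m >> * p)) (Some (mmul m j)).
Proof.
move=> pj; apply/deg_leP => i /msuppM_le[i1 [i2 [/(fsubsetP msuppU_le)]]].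
rewrite in_fset1 => /eqP -> i2p -> /=; rewrite ![mmul m _]mulmC.
apply: (mo_add mo); move: i2 i2p; apply/(@deg_leP p (Some j)); rewrite pj.
exact: mo_refl.
Qed.

(** The remainder condition in terms of exponents: divisibility of monomials becomes translation by
    some [m']. Zero entries of [F] have degree [None] and so impose nothing. *)
Definition lead_reduced (I : finType) (F : I -> poly) r :=
  forall j, j \in msupp r ->
  forall i m m', deg (F i) = Some m -> j <> mmul m' m.

Lemma lead_reduced0 (I : finType) (F : I -> poly) : lead_reduced F 0.
Proof. by move=> j; rewrite msupp0. Qed.

Lemma lead_reducedD (I : finType) (F : I -> poly) p q :
  lead_reduced F p -> lead_reduced F q -> lead_reduced F (p + q).
Proof.
move=> Fp Fq j /(fsubsetP (msuppD_le _ _)); rewrite in_fsetU.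
by case/orP => [/Fp|/Fq].
Qed.

(** The last two clauses together say that the degree falls strictly below [j]; this form also
    covers a difference equal to zero. *)
Lemma division_step (I : finType) (F : I -> poly) f j :
  deg f = Some j -> exists (a : I -> poly) r,
  [/\ forall i, ledeg (deg (a i * F i)) (deg f), lead_reduced F r,
      ledeg (deg (f - (\sum_i a i * F i + r))) (Some j) &
      (f - (\sum_i a i * F i + r))@_j = 0].
Proof.
move=> fj; have [[i [m [m' [Fim jE]]]]|nred] := pselect
  (exists i m m', deg (F i) = Some m /\ j = mmul m' m).
  (* The coefficient makes the term of [h * F i] at [j] equal to that of [f]; the division is
     legitimate because [(F i)@_m] is a leading coefficient. *)
  pose h : poly := << f@_j / (F i)@_m *g m' >>.
  have hF : ledeg (deg (h * F i)) (Some j) by rewrite jE; apply: deg_leUM.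
  have aE l : (if l == i then h else 0) * F l = if l == i then h * F i else 0.
    by case: eqP => [->//|_]; rewrite mul0r.
  exists (fun l => if l == i then h else 0), 0; split.
  - by move=> l; rewrite aE fj; case: ifP; rewrite ?deg0.
  - exact: lead_reduced0.
  - rewrite addr0; apply: deg_leD; first by rewrite fj /=; apply: mo_refl.
    rewrite deg_leN; apply: deg_sum_le => l _; rewrite aE.
    by case: ifP; rewrite ?deg0.
  - have Fi0 : (F i)@_m != 0.
      have /(degP mo)[n [nE ns _]] : F i != 0.
        by apply/eqP => F0; move: Fim; rewrite F0 deg0.
      by rewrite mcoeff_neq0; move: nE; rewrite Fim => -[->].
    rewrite addr0 (eq_bigr _ (fun l _ => aE l)) -big_mkcond big_pred1_eq.
    by rewrite mcoeffB {2}jE mcoeffUM divfK // subrr.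
(* No leading exponent of [F] divides [j], so the whole leading term goes to the remainder. *)
exists (fun=> 0), << f@_j *g j >>.
rewrite (eq_bigr (fun=> 0)) => [|l _]; last by rewrite mul0r.
rewrite big1_eq add0r; split.
- by move=> i; rewrite mul0r deg0.
- move=> l /(fsubsetP msuppU_le); rewrite in_fset1 => /eqP -> i m m' Fim jE.
  by apply: nred; exists i, m, m'.
- apply: deg_leD; first by rewrite fj /=; apply: mo_refl.
  rewrite deg_leN; apply/deg_leP => l /(fsubsetP msuppU_le).
  by rewrite in_fset1 => /eqP ->; apply: mo_refl.
- by rewrite mcoeffB mcoeffUU subrr.
Qed.

Lemma division (I : finType) (F : I -> poly) f :
  exists (a : I -> poly) r,
  [/\ f = \sum_i a i * F i + r,
      forall i, ledeg (deg (a i * F i)) (deg f) & lead_reduced F r].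
Proof.
(* Zero has no exponent as degree, so the induction on [j] cannot reach it. This case serves both
   for [f] and for a difference that vanishes after one step. *)
have division0 : exists (a : I -> poly) r,
    [/\ 0 = \sum_i a i * F i + r,
      forall i, ledeg (deg (a i * F i)) (deg 0) & lead_reduced F r].
  exists (fun=> 0), 0; split; last exact: lead_reduced0.
    by rewrite big1 ?addr0 // => i _; rewrite mul0r.
  by move=> i; rewrite mul0r; apply: deg0_le.
have [-> //|f0] := eqVneq f 0; have [j [fj _ _]] := degP mo f0.
elim/(well_founded_ind (monomial_order_wf mo)): j f {f0} fj => j IH f fj.
have [a0 [r0 [a0f r0F]]] := division_step F fj.
set f' := f - _ => f'j f'j0.
have fE : f = \sum_i a0 i * F i + r0 + f' by rewrite addrC subrK.
have [a1 [r1 [f'E a1f' r1F]]] : exists (a : I -> poly) r,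
    [/\ f' = \sum_i a i * F i + r,
      forall i, ledeg (deg (a i * F i)) (deg f') & lead_reduced F r].
  have [-> //|/(degP mo)[l [f'l ls _]]] := eqVneq f' 0.
  (* The new degree [l] is at most [j], and differs from [j] because the coefficient of [f'] at [j]
     is zero while the one at [l] is not. *)
  apply: IH f'l; move: f'j => /deg_leP/(_ _ ls) /= -> /=.
  by apply: contraTneq ls => ->; rewrite -mcoeff_neq0 f'j0 eqxx.
exists (fun i => a0 i + a1 i), (r0 + r1); split.
- under eq_bigr do rewrite mulrDl.
  rewrite big_split /= {1}fE f'E; exact: addrACA.
- move=> i; rewrite mulrDl; apply: deg_leD => //.
  (* The later quotients are bounded by [deg f'], which is at most [deg f]. *)
  by apply: ledeg_trans (a1f' i) _; rewrite fj.
- exact: lead_reducedD.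
Qed.

(** If [h] times the leading monomial equals the term at [j], whose coefficient is nonzero, then [j]
    lies in the support of that product, hence is a translate of the leading exponent. *)
Lemma lead_reduced_ndivides (I : finType) (F : I -> poly) r i j :
  lead_reduced F r -> j \in msupp r -> F i <> 0 ->
  ~ divides (LM le (F i)) << r@_j *g j >>.
Proof.
move=> Fr jr /eqP/(degP mo)[m [Fim _ _]] [h].
rewrite /LM Fim => /(congr1 (mcoeff j)); rewrite mcoeffUU => jE.
have /msuppM_le[m' [n [_ /(fsubsetP msuppU_le)]]] :
  j \in msupp (h * << m >>) by rewrite -mcoeff_neq0 -jE mcoeff_neq0.
by rewrite in_fset1 => /eqP ->; apply: Fr jr _ _ _ Fim.
Qed.

End Division.

Theorem theorem1 (k : fieldType) (sigma : choiceType)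
    (le : rel {cmonom sigma}) (hle : monomial_order le)
    (f : {malg k[{cmonom sigma}]}) (s : nat)
    (F : s.-tuple {malg k[{cmonom sigma}]}) :
  exists (a : s.-tuple {malg k[{cmonom sigma}]}) (r : {malg k[{cmonom sigma}]}),
    f = \sum_(i < s) tnth a i * tnth F i + r
    /\ is_remainder le f [set tnth F i | i in [set: 'I_s]] r.
Proof.
have [a [r [fE af rF]]] := division hle (tnth F) f.
exists [tuple a i | i < s], r; split.
  rewrite {1}fE; apply: (congr1 (+%R^~ r)).
  by apply: eq_bigr => i _; rewrite tnth_mktuple.
pose B := [fset tnth F i | i in 'I_s]%fset.
(* Coinciding entries of the tuple are a single element of the set, which
   collects all their coefficients. *)
pose gB b := \sum_(i | tnth F i == b) a i.
pose g := [fsfun b in B => gB b] : {fsfun {malg k[{cmonom sigma}]} -> _ with 0}.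
have gE b : g b = if b \in B then gB b else 0 by rewrite fsfunE.
exists g; split.
- move=> b /(fsubsetP (finsupp_sub _ _ _)) /imfsetP[i _ ->].
  by exists i.
- rewrite {1}fE; apply: (congr1 (+%R^~ r)).
  (* The support of [g] may be smaller than [B], since collected coefficients can cancel; the added
     summands are zero. *)
  apply/esym; rewrite (big_fset_incl _ (finsupp_sub _ _ _)); last first.
    by move=> b _ /fsfun_dflt ->; rewrite mul0r.
  rewrite big_seq; under eq_bigr => b bB do rewrite gE bB mulr_suml.
  (* After exchanging the sums, each index [i] meets exactly one element of [B], namely
     [tnth F i]. *)
  rewrite -big_seq (exchange_big_dep xpredT) //=; apply: eq_bigr => i _.
  rewrite -big_filter (eq_filter (a2 := pred1 (tnth F i))) => [|b];
    last exact: eq_sym.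
  by rewrite filter_pred1_uniq ?big_seq1 ?fset_uniq //; apply: in_imfset.
- move=> _ [i _ <-]; rewrite gE; case: ifP => [_|]; last first.
    by rewrite mul0r deg0.
  (* Each collected product is a sum of products [a l * F l], all bounded by [deg f]. *)
  rewrite mulr_suml; apply: (deg_sum_le hle) => l /eqP <-; exact: af.
- by move=> j jr _ [i _ <-]; apply: (lead_reduced_ndivides hle rF jr).
Qed.
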